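(* Let $t\ge 2$, $N=t+2$, and let $\lambda$ be a partition with at most $N$ parts. Let $\Phi_t(\lambda;z)=s_\lambda(1,\zeta,\dots,\zeta^{t-1},z,z^{-1})$ with $\zeta=e^{2\pi i/t}$. (i) If $n_i(\lambda)=0$ for some $i$, then $\Phi_t(\lambda;z)=0$. (ii) Otherwise either exactly two residue classes have $n_i=2$ (and all others $n_i=1$), or exactly one has $n_i=3$ (and all others $n_i=1$). Let $r_A\le r_B$ be the residues involved and let $A=\{a_1>a_2\}$, $B=\{b_1>b_2\}$ be, in the first case, the parts of $\beta(\lambda)$ in the classes $r_A$ and $r_B$, and in the second case the two overlapping pairs $A=\{p,q\}$, $B=\{q,r\}$ of the class $\{p>q>r\}$ (so $r_A=r_B$). Set $$d_1=a_1-a_2,\quad d_2=b_1-b_2,\quad \tilde d_3=a_1+a_2-b_1-b_2,\quad d_3=|\tilde d_3|.$$ If $\tilde d_3=0$ then $\Phi_t(\lambda;z)=0$. Otherwise, with $z=e^\theta$, $$\Phi_t(\lambda;z)=\varepsilon_\lambda\,\frac{\sinh(d_1\theta/2)\,\sinh(d_2\theta/2)\,\sinh(d_3\theta/2)}{\sinh^2(t\theta/2)\,\sinh\theta},$$ where, writing $j_{A_1}$ and $j_{B_1}$ for the columns carrying $a_1$ and $b_1$ (i.e. $\beta_{j_{A_1}}=a_1$, $\beta_{j_{B_1}}=b_1$), $S=\{1,\dots,N\}\setminus\{j_{A_1},j_{B_1}\}$, and $b_S$ for the word of residues $\beta_j \bmod t$, $j\in S$, read in increasing order of $j$, $$\varepsilon_\lambda=(-1)^{\,t+\binom{N+1}{2}}\,(-1)^{\,j_{A_1}+j_{B_1}+\operatorname{inv}(b_S)}\,\operatorname{sgn}(a_1-b_1)\,\operatorname{sgn}(\tilde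 d_3)\in\{\pm1\}.$$
   Context: For $\lambda=(\lambda_1\ge\dots\ge\lambda_N\ge0)$ (padded with zeros to $N$ parts) the beta set is $\beta(\lambda)=(\beta_1>\beta_2>\dots>\beta_N\ge0)$ with $\beta_j=\lambda_j+N-j$; the index $j\in\{1,\dots,N\}$ is called the column of $\beta_j$. For $0\le i\le t-1$, $n_i(\lambda)$ is the number of $j$ with $\beta_j\equiv i\pmod t$; since $\sum_i n_i=t+2$, when no $n_i$ vanishes only the two profiles in (ii) can occur. $\operatorname{inv}(b)$ is the number of inversions of a word $b$ of integers (pairs of positions $p<q$ with $b_p>b_q$), residues being taken in $\{0,\dots,t-1\}$. $s_\lambda$ is the Schur polynomial in $N$ variables. The displayed identity is read as an identity of rational functions (both sides are Laurent polynomials in $z$ after cancellation). *)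

(* Defs.v *)
From HB Require Import structures.
From mathcomp Require Import all_boot all_order all_fingroup all_algebra.
From mathcomp Require Import all_classical all_reals all_analysis.
From mathcomp Require Import complex.
(* The notations of [mpoly] clash with those of mathcomp-analysis. *)
From mathcomp Require Import -(notations) mpoly.

Set Implicit Arguments.
Unset Strict Implicit.
Unset Printing Implicit Defensive.

Import Order.TTheory GRing.Theory Num.Theory.
Local Open Scope ring_scope.

(* Columns are numbered 1, ..., N, and parts of [lam] beyond its size are 0. *)
Definition beta (N : nat) (lam : seq nat) (j : nat) : nat :=
  (nth 0 lam j.-1 + (N - j))%N.

Definition columns (N : nat) : seq nat := iota 1 N.

Definition alternant (R : comNzRingType) (n : nat) (x : 'I_n -> R)
    (lam : seq nat) : R :=
  \det (\matrix_(i < n, j < n) x i ^+ beta n lam j.+1).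

Lemma alternant_dvd (R : comNzRingType) (n : nat) (x : 'I_n -> R)
    (lam : seq nat) :
  exists s : R, s * alternant x [::] = alternant x lam.
Proof.
pose P : {poly R} := \prod_(i < n) ('X - (x i)%:P).
have mP : P \is monic by exact: monic_prod_XsubC.
have sP : size P = n.+1 by rewrite size_prod_XsubC /index_enum -enumT size_enum_ord.
pose c (j : 'I_n) := Pdiv.Ring.rmodp ('X^(beta n lam j.+1)) P.
have sc j : (size (c j) <= n)%N.
  by rewrite -ltnS -sP Pdiv.Ring.ltn_rmodp monic_neq0.
have Pi i : P.[x i] = 0.
  by rewrite /P horner_prod (bigD1 i) //= hornerXsubC subrr mul0r.
exists (\det (\matrix_(k < n, j < n) (c j)`_(n - k.+1))).
rewrite mulrC -det_mulmx; congr (\det _).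
apply/matrixP => i j; rewrite !mxE.
have -> : x i ^+ beta n lam j.+1 = (c j).[x i].
  rewrite -hornerXn {1}(Pdiv.RingMonic.rdivp_eq mP ('X^(beta n lam j.+1))).
  by rewrite hornerD hornerM Pi mulr0 add0r.
rewrite (horner_coef_wide _ (sc j)) [RHS](reindex_inj rev_ord_inj) /=.
by apply: eq_bigr => k _; rewrite !mxE /beta nth_nil add0n mulrC.
Qed.

Lemma alternant_nil_neq0 (R : idomainType) (n : nat) (x : 'I_n -> R) :
  injective x -> alternant x [::] != 0.
Proof.
move=> xI; pose y : 'rV[R]_n := \row_i x (rev_ord i).
pose p := perm (@rev_ord_inj n).
have -> : alternant x [::] = \det (row_perm p (col_perm p (Vandermonde n y)^T)).
  congr (\det _); apply/matrixP => i j.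
  by rewrite !mxE !permE rev_ordK /beta nth_nil add0n.
rewrite row_permE col_permE !det_mulmx !det_perm det_tr det_Vandermonde.
rewrite !mulf_neq0 ?signr_eq0 //.
apply/prodf_neq0 => i _; apply/prodf_neq0 => j ij.
rewrite !mxE subr_eq0; apply: contraTneq ij => /xI/rev_ord_inj ->.
by rewrite ltnn.
Qed.

Definition mpvar (n : nat) (i : 'I_n) : mpoly.mpoly n int :=
  mpoly.mpolyX int (mpoly.mnm1 i).

Lemma mpvar_inj (n : nat) : injective (@mpvar n).
Proof.
move=> i j /(congr1 (fun p => mpoly.mcoeff (mpoly.mnm1 i) p)).
rewrite /mpvar !mpoly.mcoeffX eqxx => /eqP.
by case: (eqVneq (mpoly.mnm1 j) (mpoly.mnm1 i)) => // /eqP; rewrite mpoly.eq_mnm1 => /eqP.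
Qed.

Lemma schur_exists (n : nat) (lam : seq nat) :
  exists s : mpoly.mpoly n int,
    s * alternant (@mpvar n) [::] == alternant (@mpvar n) lam.
Proof. by have [s <-] := alternant_dvd (@mpvar n) lam; exists s. Qed.

(* The quotient of alternants a_(lambda + delta) / a_delta, which is a
   polynomial ([schur_exists]) and is unique ([schur_unique]). *)
Definition schur (n : nat) (lam : seq nat) : mpoly.mpoly n int :=
  xchoose (schur_exists n lam).

Lemma schurP (n : nat) (lam : seq nat) :
  schur n lam * alternant (@mpvar n) [::] = alternant (@mpvar n) lam.
Proof. exact/eqP/(xchooseP (schur_exists n lam)). Qed.

Lemma schur_unique (n : nat) (lam : seq nat) (s : mpoly.mpoly n int) :
  s * alternant (@mpvar n) [::] = alternant (@mpvar n) lam -> s = schur n lam.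
Proof.
rewrite -(schurP n lam); apply: mulIf; exact/alternant_nil_neq0/mpvar_inj.
Qed.

Definition expC (R : realType) (w : R[i]) : R[i] :=
  Complex (expR (complex.Re w) * cos (complex.Im w))
          (expR (complex.Re w) * sin (complex.Im w)).

Definition sinhC (R : realType) (w : R[i]) : R[i] :=
  (expC w - expC (- w)) / 2.

Definition zeta (R : realType) (t : nat) : R[i] :=
  expC (Complex 0 (2 * pi / t%:R)).

(* The point (1, zeta, ..., zeta^(t-1), z, z^-1). *)
Definition Phi_point (R : realType) (t : nat) (z : R[i]) (i : 'I_(t + 2)) : R[i] :=
  if (i < t)%N then zeta R t ^+ i else if (i == t :> nat) then z else z^-1.

Definition Phi (R : realType) (t : nat) (lam : seq nat) (z : R[i]) : R[i] :=
  mpoly.mmap intr (@Phi_point R t z) (schur (t + 2) lam).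

Definition nres (t : nat) (lam : seq nat) (i : nat) : nat :=
  count (fun j => beta (t + 2) lam j %% t == i)%N (columns (t + 2)).

(* Listed in decreasing order when [lam] is a partition. *)
Definition class_parts (t : nat) (lam : seq nat) (r : nat) : seq nat :=
  [seq b <- [seq beta (t + 2) lam j | j <- columns (t + 2)] | (b %% t)%N == r].

Definition two_double_classes (t : nat) (lam : seq nat) : Prop :=
  exists rA rB : nat,
    [/\ (rA < rB < t)%N, nres t lam rA = 2%N, nres t lam rB = 2%N &
        forall i : nat, (i < t)%N -> i <> rA -> i <> rB -> nres t lam i = 1%N].

Definition one_triple_class (t : nat) (lam : seq nat) : Prop :=
  exists r : nat,
    [/\ (r < t)%N, nres t lam r = 3%N &
        forall i : nat, (i < t)%N -> i <> r -> nres t lam i = 1%N].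

(* A = {a1 > a2} and B = {b1 > b2}: either the parts in two distinct classes
   rA < rB, or the two overlapping pairs {p, q}, {q, r} of one class
   {p > q > r}, in which case rA = rB and a2 = q = b1. *)
Definition AB_pairs (t : nat) (lam : seq nat) (rA rB a1 a2 b1 b2 : nat) : Prop :=
  [/\ (rA < rB < t)%N, class_parts t lam rA = [:: a1; a2] &
      class_parts t lam rB = [:: b1; b2]]
  \/ [/\ rA = rB, (rB < t)%N, a2 = b1 &
         class_parts t lam rA = [:: a1; a2; b2]].

Definition word_inv (b : seq nat) : nat :=
  #|[set pq : 'I_(size b) * 'I_(size b) |
      (pq.1 < pq.2)%N && (nth 0 b pq.2 < nth 0 b pq.1)%N]|.

Definition residue_word (t : nat) (lam : seq nat) (jA jB : nat) : seq nat :=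
  [seq (beta (t + 2) lam j %% t)%N
    | j <- columns (t + 2) & (j != jA) && (j != jB)].

Definition eps (t : nat) (lam : seq nat) (a1 b1 jA jB : nat) (d3t : int) : int :=
  (-1) ^+ (t + 'C((t + 2).+1, 2))
  * (-1) ^+ (jA + jB + word_inv (residue_word t lam jA jB))
  * Num.sg (a1%:Z - b1%:Z) * Num.sg d3t.

(* Main.v *)
Require Import Defs.
From mathcomp Require Import all_boot all_order all_fingroup all_algebra.
From mathcomp Require Import all_classical all_reals all_analysis.
From mathcomp Require Import complex.
From mathcomp Require Import -(notations) mpoly.
From mathcomp Require Import zify ring lra.

Set Implicit Arguments.
Unset Strict Implicit.
Unset Printing Implicit Defensive.

Import Order.TTheory GRing.Theory Num.Theory.
Local Open Scope ring_scope.

(** Since [zeta ^ t = 1], the first [t] rows of the matrix [x_i ^ beta_j] only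
    depend on the residues of the [beta_j]: they are the Fourier matrix times
    the 0/1 matrix of residue classes. The Fourier determinant cancels in the
    quotient of alternants. What remains is a determinant whose top rows are
    class indicators and whose last two rows are [z ^ beta_j], [z ^ - beta_j].
    An empty class gives a zero row. Otherwise the columns other than [j_A] and
    [j_B] carry every residue exactly once; sorting them, with [j_A] and [j_B]
    moved last, costs a sign given by counting inversions, and leaves a Schur
    complement of size 2, which with [z = w ^ 2] factors into the three
    differences of the formula. The denominator is the same determinant for the
    empty partition. When [z] is a root of the denominator, [Phi t lam z = 0]
    follows because [Phi t lam] is a Laurent polynomial. *)

(** * Inversions of words and signs of permutations *)

Lemma word_invE (b : seq nat) :
  word_inv b = (\sum_(i < size b) \sum_(j < size b)
                  ((i < j) && (nth 0 b j < nth 0 b i)))%N.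
Proof.
rewrite /word_inv -sum1_card pair_bigA /= big_mkcond /=.
by apply: eq_bigr => -[i j] _; rewrite inE /=; case: ifP.
Qed.

Lemma word_inv_cons (x : nat) (s : seq nat) :
  word_inv (x :: s) = (count (ltn^~ x) s + word_inv s)%N.
Proof.
rewrite !word_invE /= big_ord_recl big_ord_recl /= add0n; congr addn.
  by rewrite -sumn_count big_seq_cond; rewrite sumnE big_map (big_nth 0%N) big_mkord -big_seq_cond.
by apply: eq_bigr => i _; rewrite big_ord_recl /= add0n.
Qed.

(** A letter larger than all others forms an inversion with every later letter and with no earlier
    one. *)
Lemma word_inv_del_max (f : nat -> nat) (s : seq nat) (j : nat) :
    sorted ltn s -> j \in s -> {in s, forall k, k != j -> f k < f j}%N ->
  word_inv [seq f k | k <- s] =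
    (word_inv [seq f k | k <- s & k != j] + count (ltn j) s)%N.
Proof.
elim: s => [|x s IHs] //= xs; rewrite inE.
have ss := path_sorted xs.
have xlt : {in s, forall k, x < k}%N.
  by move/(order_path_min ltn_trans)/allP: xs.
have [jx|jx /= js fmax] := eqVneq j x; last first.
  rewrite !word_inv_cons.
  rewrite IHs //; last by move=> k ks; apply: fmax; rewrite inE ks orbT.
  rewrite ltnNge ltnW ?xlt //= add0n addnA; congr (_ + _ + _)%N.
  rewrite !count_map count_filter; apply: eq_in_count => k ks /=.
  have [->|] := eqVneq k j; last by rewrite andbT.
  rewrite andbF; apply/negbTE; rewrite -leqNgt ltnW // fmax ?mem_head //.
  by rewrite eq_sym.
have neqx : {in s, forall k, k != x} by move=> k /xlt; rewrite ltn_neqAle eq_sym => /andP[].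
rewrite {j IHs}jx => _ fmax.
rewrite /= word_inv_cons ltnn add0n addnC; congr addn.
  by congr (word_inv (map _ _)); apply/esym/all_filterP/allP.
rewrite count_map; apply: eq_in_count => k ks /=.
by rewrite xlt // fmax ?neqx // inE ks orbT.
Qed.

Lemma count_ltn_iota (N j : nat) :
  (1 <= j <= N)%N -> count (ltn j) (iota 1 N) = (N - j)%N.
Proof.
move=> /andP[_ jN]; rewrite -{1}(subnKC jN) iotaD count_cat.
rewrite (@eq_in_count _ _ pred0) ?count_pred0; last first.
  by move=> k; rewrite mem_iota => /andP[_ ?] /=; lia.
rewrite (@eq_in_count _ _ predT) ?count_predT ?size_iota //.
by move=> k; rewrite mem_iota => /andP[? _] /=; lia.
Qed.

(** The largest letter, at [jB], is deleted first, then the one at [jA]. If [jA < jB], the position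
    [jB] is already gone when the letters after [jA] are counted, whence the correction. *)
Lemma word_inv_two_max (f : nat -> nat) (N jA jB : nat) :
    (1 <= jA <= N)%N -> (1 <= jB <= N)%N -> jA != jB ->
    (f jA < f jB)%N ->
    (forall k, k \in iota 1 N -> k != jA -> k != jB -> (f k < f jA)%N) ->
  word_inv [seq f k | k <- iota 1 N] =
    (word_inv [seq f k | k <- iota 1 N & (k != jA) && (k != jB)]
       + ((N - jA) - (jA < jB)) + (N - jB))%N.
Proof.
move=> hA hB hAB fAB fS.
have mem j : (j \in iota 1 N) = (1 <= j <= N)%N by rewrite mem_iota add1n ltnS.
rewrite (@word_inv_del_max f _ jB) ?iota_ltn_sorted ?mem //; last first.
  move=> k kN kB; have [->//|kA] := eqVneq k jA.
  exact: ltn_trans (fS _ kN kA kB) fAB.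
rewrite count_ltn_iota //; congr addn.
rewrite (@word_inv_del_max f _ jA).
- rewrite -filter_predI; congr addn.
  rewrite -(count_ltn_iota hA) -[in RHS]size_filter.
  rewrite -(count_predC (pred1 jB)) !count_filter addnC.
  rewrite [X in (_ = _ + X - _)%N](_ : _ = (jA < jB)%N :> nat); last first.
    rewrite (@eq_count _ _ (predI (fun _ => jA < jB)%N (pred1 jB))); last first.
      by move=> k /=; case: eqP => [->|]; rewrite ?andbT ?andbF.
    case: (jA < jB)%N; last exact: count_pred0.
    by rewrite (@eq_count _ _ (pred1 jB)) // count_uniq_mem ?iota_uniq // mem hB.
  rewrite addnK; apply: eq_count => k /=; exact: andbC.
- exact/sorted_filter/iota_ltn_sorted/ltn_trans.
- by rewrite mem_filter hAB mem.
- by move=> k; rewrite mem_filter => /andP[kB kN] kA; apply: fS.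
Qed.

Lemma signr_perm_word_inv (n : nat) (s : 'S_n) :
  (-1) ^+ s = (-1) ^+ word_inv [seq val (s i) | i <- enum 'I_n] :> int.
Proof.
(* Permuting the columns of the Vandermonde matrix of 0, ..., n - 1 by [s]
   multiplies its determinant by the sign of [s]; compare the signs of the two
   products of differences. *)
pose a : 'rV[int]_n := \row_i (i : nat)%:Z.
pose b : 'rV[int]_n := \row_i (s i : nat)%:Z.
have : \det (Vandermonde n b) = \det (Vandermonde n a) * (-1) ^+ s.
  rewrite -[in RHS]odd_permV -det_perm -det_mulmx -col_permE; congr (\det _).
  by apply/matrixP => i j; rewrite !mxE.
rewrite !det_Vandermonde => /(congr1 Num.sg).
have sgprod (I : finType) (P : pred I) (F : I -> int) :
    Num.sg (\prod_(i | P i) F i) = \prod_(i | P i) Num.sg (F i).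
  by apply: (big_morph Num.sg) => [x y|]; rewrite ?sgrM ?sgr1.
rewrite sgrM !sgprod.
under eq_bigr do rewrite sgprod; under [in RHS]eq_bigr do rewrite sgprod.
rewrite [X in _ = X * _]big1; last first.
  by move=> i _; rewrite big1 // => j ij; rewrite !mxE gtr0_sg // subr_gt0.
rewrite mul1r => sgE.
have -> : (-1) ^+ s = Num.sg ((-1) ^+ s) :> int.
  by case: (odd_perm s); rewrite ?sgrN sgr1.
rewrite -sgE word_invE size_map size_enum_ord.
rewrite -[RHS]prodrXr; apply: eq_bigr => i _.
rewrite -prodrXr big_mkcond; apply: eq_bigr => j _.
have nthE (k : 'I_n) : nth 0%N [seq val (s i) | i <- enum 'I_n] k = s k.
  by rewrite (nth_map k) ?size_enum_ord // nth_ord_enum.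
rewrite !nthE !mxE; case: ltnP => //= ij.
have : s i != s j by rewrite (inj_eq perm_inj) neq_ltn ij.
rewrite neq_ltn => /orP[] h.
  by rewrite gtr0_sg ?subr_gt0 // ltnNge ltnW.
by rewrite ltr0_sg ?subr_lt0 // h.
Qed.

(** * Factoring the alternant and reducing it to size 2 *)

(* [class_mx] for [b = beta]: the alternant matrix with the Fourier factor
   removed from its first [t] rows. *)
Definition class_mx (K : fieldType) (t : nat) (b : 'I_(t + 2) -> nat) (z : K) :
    'M[K]_(t + 2) :=
  col_mx (\matrix_(r < t, j < t + 2) (b j %% t == r)%N%:R)
         (\matrix_(k < 2, j < t + 2) (if k == 0 then z else z^-1) ^+ b j).

(* The 2x2 determinant with columns [(z ^ a1 - z ^ a2, z ^ - a1 - z ^ - a2)] and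
   [(z ^ b1 - z ^ b2, z ^ - b1 - z ^ - b2)]. *)
Definition alt2 (K : fieldType) (z : K) (a1 a2 b1 b2 : nat) : K :=
  (z ^+ a1 - z ^+ a2) * (z^-1 ^+ b1 - z^-1 ^+ b2)
  - (z ^+ b1 - z ^+ b2) * (z^-1 ^+ a1 - z^-1 ^+ a2).

Lemma alternant_class_mx (K : fieldType) (t : nat) (q z : K) (lam : seq nat) :
    (0 < t)%N -> q ^+ t = 1 ->
  alternant (fun i : 'I_(t + 2) =>
      if (i < t)%N then q ^+ i else if i == t :> nat then z else z^-1) lam =
    \det (\matrix_(i < t, r < t) q ^+ (i * r))
    * \det (class_mx (fun j : 'I_(t + 2) => beta (t + 2) lam j.+1) z).
Proof.
move=> t_gt0 qt1.
(* The Fourier matrix is padded with an identity block of size 2, so that the factorization is a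
   product of square matrices. *)
rewrite -[X in _ = X * _]mulr1 -(det1 K 2) -(det_ublock _ 0) -det_mulmx.
rewrite mul_block_col !mul0mx addr0 add0r mul1mx; congr (\det _).
apply/matrixP => i j; rewrite -(fintype.splitK i); case: (fintype.split i) => [r | k] /=.
  rewrite col_mxEu !mxE /= ltn_ord.
  pose r0 : 'I_t := Ordinal (ltn_pmod (beta (t + 2) lam j.+1) t_gt0).
  rewrite (bigD1 r0) //= big1 => [|r1 /negPf r1r0].
    by rewrite !mxE eqxx mulr1 addr0 -exprM
      [in LHS](divn_eq (beta _ _ _) t) mulnDr mulnA [(_ * t)%N]mulnC
      exprD exprM qt1 expr1n mul1r. 
  by rewrite !mxE -[_ == _ :> nat]/(r0 == r1) eq_sym r1r0 mulr0.
rewrite col_mxEd !mxE /= ltnNge leq_addr /= -[X in (_ == X)%N]addn0 eqn_add2l.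
by [].
Qed.

Lemma det_mx22 (K : comNzRingType) (A : 'M[K]_2) :
  \det A = A 0 0 * A 1 1 - A 0 1 * A 1 0.
Proof.
rewrite (expand_det_row _ 0) !big_ord_recl big_ord0 /cofactor !det_mx11 !mxE /=.
rewrite expr0 expr1 addr0 mul1r mulN1r mulrN.
by congr (_ * A _ _ - A _ _ * A _ _); apply: val_inj.
Qed.

(** After the columns are permuted by [s], the top left block is the identity. The last two columns
    of the top block are unit vectors at [rA] and [rB], so the Schur complement subtracts from each
    of the last two columns the column of the same residue. *)
Lemma det_class_mx (K : fieldType) (t : nat) (b : 'I_(t + 2) -> nat) (z : K)
    (s : 'S_(t + 2)) (rA rB : 'I_t) :
    (forall r : 'I_t, b (s (lshift 2 r)) %% t = r)%N ->
    (b (s (rshift t ord0)) %% t = rA)%N ->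
    (b (s (rshift t ord_max)) %% t = rB)%N ->
  \det (class_mx b z) =
    (-1) ^+ s * alt2 z (b (s (rshift t ord0))) (b (s (lshift 2 rA)))
                       (b (s (rshift t ord_max))) (b (s (lshift 2 rB))).
Proof.
move=> bS bA bB.
suff detE : \det (col_perm s (class_mx b z)) =
    alt2 z (b (s (rshift t ord0))) (b (s (lshift 2 rA)))
           (b (s (rshift t ord_max))) (b (s (lshift 2 rB))).
  by rewrite -detE col_permE det_mulmx det_perm odd_permV mulrCA -signr_addb addbb mulr1.
pose c (k : 'I_2) := if k == 0 then z else z^-1.
pose U : 'M[K]_(t, 2) := \matrix_(r, k) ((if k == 0 then rA else rB) == r)%:R.
pose V : 'M[K]_(2, t) := \matrix_(k, r) c k ^+ b (s (lshift 2 r)).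
pose W : 'M[K]_2 := \matrix_(k, l) c k ^+ b (s (rshift t l)).
have -> : col_perm s (class_mx b z) = block_mx 1%:M 0 V 1%:M *m block_mx 1%:M U 0 (W - V *m U).
  rewrite mulmx_block !mulmx1 !mulmx0 !mul1mx !mul0mx !addr0 addrC subrK.
  apply/matrixP => i j; rewrite [LHS]mxE.
  rewrite -(fintype.splitK i); case: (fintype.split i) => i' /=;
  rewrite -(fintype.splitK j); case: (fintype.split j) => j' /=;
  rewrite ?block_mxEul ?block_mxEur ?block_mxEdl ?block_mxEdr ?col_mxEu ?col_mxEd !mxE //.
    by rewrite bS eq_sym.
  congr ((nat_of_bool _)%:R); rewrite -[RHS]val_eqE.
  case: (unliftP ord0 j') => [j1|] -> /=; last by rewrite bA.
  have -> : lift ord0 j1 = ord_max by rewrite ord1; apply: val_inj.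
  by rewrite bB.
rewrite det_mulmx det_lblock det_ublock !det1 !mul1r.
have VU k l : (V *m U) k l = V k (if l == 0 then rA else rB).
  rewrite !mxE (bigD1 (if l == 0 then rA else rB)) //= big1 ?addr0.
    by rewrite !mxE eqxx mulr1.
  by move=> r /negPf h; rewrite !mxE eq_sym h mulr0.
have WVU k l : (W - V *m U) k l = W k l - V k (if l == 0 then rA else rB).
  by rewrite -VU mxE; congr (_ + _); rewrite mxE.
rewrite det_mx22 !WVU !mxE /= /alt2.
have -> : ord_max = 1 :> 'I_2 by apply: val_inj.
have -> : ord0 = 0 :> 'I_2 by apply: val_inj.
by [].
Qed.

(** With [z = w ^+ 2], a difference [z ^ m - z ^ n] is [w ^ (m + n)] times
    [w ^ (m - n) - w ^ (n - m)]. Both products in [alt2] then share the factors for [a1 - a2] and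
    [b1 - b2], and the remaining powers of [w] form the third difference. *)
Lemma alt2_prod (K : fieldType) (w : K) (a1 a2 b1 b2 : nat) : w != 0 ->
  alt2 (w ^+ 2) a1 a2 b1 b2 =
    - ((w ^ (a1%:Z - a2%:Z) - w ^ (a2%:Z - a1%:Z))
       * (w ^ (b1%:Z - b2%:Z) - w ^ (b2%:Z - b1%:Z))
       * (w ^ (a1%:Z + a2%:Z - b1%:Z - b2%:Z)
          - w ^ (b1%:Z + b2%:Z - a1%:Z - a2%:Z))).
Proof.
move=> w0.
have pw m n : w ^ (m%:Z - n%:Z) = w ^+ m / w ^+ n by rewrite expfzDr // -exprnN.
have -> : a1%:Z + a2%:Z - b1%:Z - b2%:Z = (a1 + a2)%:Z - (b1 + b2)%:Z by lia.
have -> : b1%:Z + b2%:Z - a1%:Z - a2%:Z = (b1 + b2)%:Z - (a1 + a2)%:Z by lia.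
rewrite /alt2 !pw !exprVn -!exprM !(mulnC 2) !exprM !exprD.
have wn n : w ^+ n != 0 by rewrite expf_neq0.
move: (wn a1) (wn a2) (wn b1) (wn b2).
move: (w ^+ a1) (w ^+ a2) (w ^+ b1) (w ^+ b2) => A B C D hA hB hC hD.
by field; rewrite hA hB hC hD.
Qed.

(** * Beta sets and residue classes *)

Lemma nth_geq_homo (lam : seq nat) (i j : nat) :
  sorted geq lam -> (i <= j)%N -> (nth 0 lam j <= nth 0 lam i)%N.
Proof.
move=> lam_s ij; have [jl|lj] := ltnP j (size lam); last by rewrite nth_default.
have geqT : transitive geq by move=> a b c /= ba cb; apply: leq_trans cb ba.
have := @sorted_leq_nth _ geq geqT leqnn 0%N _ lam_s i j.
by rewrite !inE jl (leq_ltn_trans ij jl); apply.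
Qed.

(** The parts decrease weakly and [N - j] strictly; the bounds on the columns keep the truncated
    subtraction strict. *)
Lemma ltn_beta (N : nat) (lam : seq nat) (i j : nat) :
    sorted geq lam -> (1 <= i <= N)%N -> (1 <= j <= N)%N ->
  (beta N lam i < beta N lam j)%N = (j < i)%N.
Proof.
move=> lam_s iN jN.
have lt k l : (1 <= k <= N)%N -> (1 <= l <= N)%N -> (k < l)%N ->
    (beta N lam l < beta N lam k)%N.
  move=> kN lN kl; rewrite /beta -addnS leq_add ?nth_geq_homo //; lia.
case: (ltngtP i j) => [h|h|->]; last exact: ltnn.
  by apply/negbTE; rewrite -leqNgt ltnW ?lt.
exact: lt.
Qed.

Lemma beta_inj (N : nat) (lam : seq nat) (i j : nat) :
    sorted geq lam -> (1 <= i <= N)%N -> (1 <= j <= N)%N ->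
  beta N lam i = beta N lam j -> i = j.
Proof.
move=> lam_s iN jN eq_b.
have := ltn_beta lam_s iN jN; have := ltn_beta lam_s jN iN.
by rewrite eq_b ltnn; case: (ltngtP i j).
Qed.

Lemma mem_columns (N j : nat) : (j \in columns N) = (1 <= j <= N)%N.
Proof. by rewrite mem_iota add1n ltnS. Qed.

Lemma class_partsP (t : nat) (lam : seq nat) (r v : nat) :
  reflect (exists2 j, 1 <= j <= t + 2 & beta (t + 2) lam j = v /\ v %% t = r)%N
          (v \in class_parts t lam r).
Proof.
rewrite mem_filter; apply: (iffP andP) => [[/eqP vr /mapP[j]]|[j jN [<- ->]]].
  by rewrite mem_columns => jN v_def; exists j; rewrite -?v_def.
by rewrite eqxx map_f // mem_columns.
Qed.

Lemma class_parts_uniq (t : nat) (lam : seq nat) (r : nat) :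
  sorted geq lam -> uniq (class_parts t lam r).
Proof.
move=> lam_s; rewrite filter_uniq // map_inj_in_uniq ?iota_uniq // => i j.
rewrite !mem_columns; exact: beta_inj.
Qed.

Lemma nres_neq0P (t : nat) (lam : seq nat) (r : nat) :
  nres t lam r <> 0%N ->
  exists2 j, (1 <= j <= t + 2)%N & (beta (t + 2) lam j %% t)%N = r.
Proof.
move=> /eqP; rewrite -lt0n -has_count => /hasP[j].
by rewrite mem_columns => jN /eqP; exists j.
Qed.

(* [cA] and [cB] are the parts left in the classes [rA] and [rB] once the columns
   [jA] and [jB] are removed: [a2] and [b2] for two classes, but both equal to
   [r] for a triple class [{p > q > r}], where subtracting columns shows that
   [alt2] is the same for [(p, r, q, r)] as for [(p, q, q, r)]. *)
Lemma AB_pairs_columns (t : nat) (lam : seq nat)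
    (rA rB a1 a2 b1 b2 jA jB : nat) :
    sorted geq lam -> AB_pairs t lam rA rB a1 a2 b1 b2 ->
    (1 <= jA <= t + 2)%N -> beta (t + 2) lam jA = a1 ->
    (1 <= jB <= t + 2)%N -> beta (t + 2) lam jB = b1 ->
  let beta_j := beta (t + 2) lam in
  let in_S j := [&& 1 <= j <= t + 2, j != jA & j != jB]%N in
  [/\ jA != jB, (rA < t)%N, (rB < t)%N, (a1 %% t = rA)%N & (b1 %% t = rB)%N] /\
  exists cA cB : nat,
    [/\ exists2 j, in_S j & (beta_j j %% t = rA)%N,
        exists2 j, in_S j & (beta_j j %% t = rB)%N,
        forall j, in_S j -> (beta_j j %% t = rA)%N -> beta_j j = cA,
        forall j, in_S j -> (beta_j j %% t = rB)%N -> beta_j j = cB &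
        forall (K : fieldType) (z : K),
          alt2 z a1 cA b1 cB = alt2 z a1 a2 b1 b2].
Proof.
move=> lam_s AB jAN bA jBN bB beta_j in_S.
have inj i j := @beta_inj (t + 2) lam i j lam_s; rewrite -/beta_j in bA bB inj.
have uA := class_parts_uniq t rA lam_s; have uB := class_parts_uniq t rB lam_s.
have col r v (h : v \in class_parts t lam r) := class_partsP t lam r v h.
have colV j r : (1 <= j <= t + 2)%N -> (beta_j j %% t = r)%N ->
    beta_j j \in class_parts t lam r.
  by move=> jN h; apply/class_partsP; exists j.
case: AB => [[/andP[rAB rBt] cA cB]|[rAB rBt ab cA]].
  rewrite cA /= inE andbT in uA; rewrite cB /= inE andbT in uB.
  have [jA' _ [_ a1r]] : exists2 j, (1 <= j <= t + 2)%N & beta_j j = a1 /\ (a1 %% t)%N = rA.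
    by apply: col; rewrite cA mem_head.
  have [jA2 jA2N [bA2 a2r]] : exists2 j, (1 <= j <= t + 2)%N & beta_j j = a2 /\ (a2 %% t)%N = rA.
    by apply: col; rewrite cA !inE eqxx orbT.
  have [jB' _ [_ b1r]] : exists2 j, (1 <= j <= t + 2)%N & beta_j j = b1 /\ (b1 %% t)%N = rB.
    by apply: col; rewrite cB mem_head.
  have [jB2 jB2N [bB2 b2r]] : exists2 j, (1 <= j <= t + 2)%N & beta_j j = b2 /\ (b2 %% t)%N = rB.
    by apply: col; rewrite cB !inE eqxx orbT.
  have neqr i j : (beta_j i %% t = rA)%N -> (beta_j j %% t = rB)%N -> i != j.
    by move=> iA jB0; apply: contraTneq rAB => ij; rewrite -iA -jB0 ij ltnn.
  split; first by split=> //; [apply: neqr; rewrite ?bA ?bB | exact: ltn_trans rBt].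
  exists a2, b2; split=> //.
  - exists jA2; last by rewrite bA2.
    rewrite /in_S jA2N (neqr jA2 jB) ?bA2 ?bB //= andbT.
    by apply: contraNneq uA => h; apply/eqP; rewrite -bA -bA2 h.
  - exists jB2; last by rewrite bB2.
    rewrite /in_S jB2N [jB2 == jA]eq_sym (neqr jA jB2) ?bA ?bB2 //=.
    by apply: contraNneq uB => h; apply/eqP; rewrite -bB -bB2 h.
  - move=> j /and3P[jN jjA _] /(colV _ _ jN); rewrite cA !inE => /orP[]/eqP //.
    by rewrite -bA => /(inj _ _ jN jAN)/eqP; rewrite (negPf jjA).
  - move=> j /and3P[jN _ jjB] /(colV _ _ jN); rewrite cB !inE => /orP[]/eqP //.
    by rewrite -bB => /(inj _ _ jN jBN)/eqP; rewrite (negPf jjB).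
subst rB.
rewrite cA /= !inE negb_or andbT in uA; case/andP: uA => /andP[a12 a1b2 a2b2].
have [jA' _ [_ a1r]] : exists2 j, (1 <= j <= t + 2)%N & beta_j j = a1 /\ (a1 %% t)%N = rA.
  by apply: col; rewrite cA mem_head.
have [jB' _ [_ a2r]] : exists2 j, (1 <= j <= t + 2)%N & beta_j j = a2 /\ (a2 %% t)%N = rA.
  by apply: col; rewrite cA !inE eqxx orbT.
have [jC jCN [bC b2r]] : exists2 j, (1 <= j <= t + 2)%N & beta_j j = b2 /\ (b2 %% t)%N = rA.
  by apply: col; rewrite cA !inE eqxx !orbT.
have jAB : jA != jB by apply: contraNneq a12 => h; apply/eqP; rewrite -bA ab -bB h.
have exC : exists2 j, in_S j & (beta_j j %% t = rA)%N.
  exists jC; last by rewrite bC.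
  apply/and3P; split=> //; first by apply: contraNneq a1b2 => h; apply/eqP; rewrite -bA -bC h.
  by apply: contraNneq a2b2 => h; apply/eqP; rewrite ab -bB -bC h.
have eqC j : in_S j -> (beta_j j %% t = rA)%N -> beta_j j = b2.
  move=> /and3P[jN jjA jjB] /(colV _ _ jN); rewrite cA !inE.
  case/or3P => /eqP //.
    by rewrite -bA => /(inj _ _ jN jAN)/eqP; rewrite (negPf jjA).
  by rewrite ab -bB => /(inj _ _ jN jBN)/eqP; rewrite (negPf jjB).
split; first by split=> //; rewrite -ab.
exists b2, b2; split=> // K z; rewrite /alt2 -ab; ring.
Qed.

(** * The class determinant of a general partition *)

Lemma sg_subz_nat (m n : nat) : m != n ->
  Num.sg (m%:Z - n%:Z) = (-1) ^+ (m < n)%N.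
Proof.
rewrite neq_ltn => /orP[] mn; rewrite ?mn.
  by rewrite ltr0_sg // subr_lt0 ltz_nat.
by rewrite gtr0_sg ?subr_gt0 ?ltz_nat // ltnNge ltnW.
Qed.

Lemma det_class_beta (K : fieldType) (t : nat) (lam : seq nat)
    (rA rB a1 a2 b1 b2 jA jB : nat) (z : K) :
    (0 < t)%N -> sorted geq lam ->
    (forall r : nat, (r < t)%N -> nres t lam r <> 0%N) ->
    AB_pairs t lam rA rB a1 a2 b1 b2 ->
    (1 <= jA <= t + 2)%N -> beta (t + 2) lam jA = a1 ->
    (1 <= jB <= t + 2)%N -> beta (t + 2) lam jB = b1 ->
  \det (class_mx (fun j : 'I_(t + 2) => beta (t + 2) lam j.+1) z) =
    - ((-1) ^+ (jA + jB + word_inv (residue_word t lam jA jB))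
       * Num.sg (a1%:Z - b1%:Z))%:~R * alt2 z a1 a2 b1 b2.
Proof.
move=> t_gt0 lam_s n_neq0 AB jAN bA jBN bB.
have [[jAB rAt rBt a1r b1r] [cA [cB [exA exB eqA eqB <-]]]] :=
  AB_pairs_columns lam_s AB jAN bA jBN bB.
(* [g k] is the position, counted from 0, to which column [k] is sorted: its residue, except that
   [jA] and [jB] go to the last two positions and so carry the two largest letters. *)
pose g k := if k == jA then t else if k == jB then t.+1
            else (beta (t + 2) lam k %% t)%N.
have gA : g jA = t by rewrite /g eqxx.
have gB : g jB = t.+1 by rewrite /g eq_sym (negPf jAB) eqxx.
have gS k : k != jA -> k != jB -> g k = (beta (t + 2) lam k %% t)%N.
  by rewrite /g => /negPf-> /negPf->.
have gt k : (g k < t)%N -> k != jA /\ k != jB.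
  have [->|kA] := eqVneq k jA; first by rewrite gA ltnn.
  by have [->|kB] := eqVneq k jB; first by rewrite gB ltnNge leqnSn.
have modt k : (beta (t + 2) lam k %% t < t)%N by rewrite ltn_mod.
have g_surj (i : 'I_(t + 2)) : exists j : 'I_(t + 2), g j.+1 = i.
  suff [k kN <-] : exists2 k, (1 <= k <= t + 2)%N & g k = i.
    by case: k kN => // k kN; exists (Ordinal kN).
  case: (ltngtP i t) => [it|ti|->]; last by exists jA.
    have fromS r : (exists2 j, [&& 1 <= j <= t + 2, j != jA & j != jB]%N &
                      (beta (t + 2) lam j %% t = r)%N) ->
                   exists2 k, (1 <= k <= t + 2)%N & g k = r.
      by move=> [j /and3P[jN ? ?] <-]; exists j; rewrite ?gS.
    (* The residues [rA] and [rB] are reached by the columns left in these classes. A column of any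
       other residue is neither [jA] nor [jB]. *)
    have [->|iA] := eqVneq (i : nat) rA; first exact: fromS.
    have [->|iB] := eqVneq (i : nat) rB; first exact: fromS.
    have [k kN kr] := nres_neq0P (n_neq0 _ it).
    exists k => //; rewrite gS //.
      by apply: contraNneq iA => kA; apply/eqP; rewrite -kr kA bA.
    by apply: contraNneq iB => kB; apply/eqP; rewrite -kr kB bB.
  by exists jB => //; rewrite gB; have := ltn_ord i; lia.
have [h hK] := fin_all_exists g_surj.
have h_inj : injective h by move=> x y hxy; apply: val_inj; rewrite /= -(hK x) hxy hK.
pose s := perm h_inj.
have hS (r : 'I_t) : [/\ (h (lshift 2 r)).+1 != jA, (h (lshift 2 r)).+1 != jB &
                     beta (t + 2) lam (h (lshift 2 r)).+1 %% t = r]%N.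
  have [kA kB] : (h (lshift 2 r)).+1 != jA /\ (h (lshift 2 r)).+1 != jB.
    by apply: gt; rewrite hK /=.
  by split=> //; rewrite -gS // hK.
have hA : (h (rshift t ord0)).+1 = jA.
  have := hK (rshift t ord0); rewrite /= addn0 /g.
  case: eqP => // _; case: eqP => _; first by lia.
  by move=> h0; have := modt (h (rshift t ord0)).+1; rewrite h0 ltnn.
have hB : (h (rshift t ord_max)).+1 = jB.
  have := hK (rshift t ord_max); rewrite /= addn1 /g.
  case: eqP => _; first by lia.
  case: eqP => // _ h0.
  by have := modt (h (rshift t ord_max)).+1; rewrite h0 ltnNge leqnSn.
have bh (r : 'I_t) : [&& 1 <= (h (lshift 2 r)).+1 <= t + 2,
    (h (lshift 2 r)).+1 != jA & (h (lshift 2 r)).+1 != jB]%N.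
  by have [-> -> _] := hS r; rewrite ltn_ord.
rewrite (@det_class_mx K t _ z s (Ordinal rAt) (Ordinal rBt)) ?permE; first last.
- by rewrite hB bB.
- by rewrite hA bA.
- by move=> r; rewrite permE; have [] := hS r.
rewrite hA hB bA bB (eqA _ (bh _)); last by have [_ _ ->] := hS (Ordinal rAt).
rewrite (eqB _ (bh _)); last by have [_ _ ->] := hS (Ordinal rBt).
congr (_ * _).
rewrite -(rmorph_sign intr) -rmorphN; congr (_%:~R).
(* [s] lists the columns by sorted position, so the word of its inverse, which has the same sign,
   consists of the values of [g] in column order. *)
rewrite -odd_permV signr_perm_word_inv.
have -> : [seq val (s^-1%g i) | i <- enum 'I_(t + 2)] = [seq g k | k <- iota 1 (t + 2)].
  rewrite (iotaDl 1 0) -val_enum_ord -!map_comp; apply: eq_map => i /=.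
  by have := hK (s^-1%g i); rewrite -[h _](permE h_inj) -/s permKV => <-.
rewrite (@word_inv_two_max g _ jA jB) // ?gA ?gB //; last first.
  by move=> k _ kA kB; rewrite gS.
have -> : [seq g k | k <- iota 1 (t + 2) & (k != jA) && (k != jB)] =
    residue_word t lam jA jB.
  by apply/eq_in_map => k; rewrite mem_filter => /andP[/andP[kA kB] _]; rewrite gS.
have sgE : Num.sg (a1%:Z - b1%:Z) = (-1) ^+ (jB < jA)%N.
  rewrite sg_subz_nat -bA -bB; last by apply: contra jAB => /eqP/beta_inj->.
  by rewrite ltn_beta.
(* Modulo 2 the two copies of [N = t + 2] cancel. As [jA != jB], the truth values of [jA < jB] and
   [jB < jA] differ by one, which accounts for the leading minus sign. *)
rewrite sgE -exprD -[RHS]mulN1r -exprS -signr_odd -[RHS]signr_odd.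
congr ((-1) ^+ nat_of_bool _); move: (word_inv _) => W.
by move: jAB; case: ltngtP => //= lt_j _; lia.
Qed.

(** * Sizes of the residue classes *)

Lemma sum_nres (t : nat) (lam : seq nat) : (0 < t)%N ->
  (\sum_(i < t) nres t lam i)%N = (t + 2)%N.
Proof.
move=> t_gt0; rewrite -[RHS](size_iota 1) /nres /columns.
elim: (iota 1 (t + 2)) => [|j s IHs] /=; first by rewrite big1.
rewrite big_split /= IHs -[RHS]add1n; congr addn.
rewrite (bigD1 (Ordinal (ltn_pmod (beta (t + 2) lam j) t_gt0))) //= eqxx.
by rewrite big1 // => i; rewrite eq_sym -val_eqE /= => /negPf->.
Qed.

(** The excesses [(m i).-1] add up to 2, hence are either 1 at two places or 2 at a single one. *)
Lemma sum_add2_profile (t : nat) (m : nat -> nat) :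
    (\sum_(i < t) m i)%N = (t + 2)%N ->
    (forall i, (i < t)%N -> m i <> 0%N) ->
  (exists rA rB : nat, [/\ (rA < rB < t)%N, m rA = 2%N, m rB = 2%N &
     forall i : nat, (i < t)%N -> i <> rA -> i <> rB -> m i = 1%N])
  \/ (exists r : nat, [/\ (r < t)%N, m r = 3%N &
     forall i : nat, (i < t)%N -> i <> r -> m i = 1%N]).
Proof.
move=> sum_m m_neq0.
have sum_pred : (\sum_(i < t) (m i).-1)%N = 2%N.
  have : (\sum_(i < t) m i = \sum_(i < t) ((m i).-1 + 1))%N.
    by apply: eq_bigr => i _; have := m_neq0 i (ltn_ord i); lia.
  by rewrite sum_m big_split /= sum1_card card_ord; lia.
have eq1 (i : 'I_t) : (m i).-1 = 0%N -> m i = 1%N.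
  by have := m_neq0 i (ltn_ord i); lia.
have [|/existsPn h0] := boolP [exists r : 'I_t, (m r).-1 != 0%N]; last first.
  by move: sum_pred; rewrite big1 // => i _; apply/eqP; rewrite -[_ == _]negbK h0.
case/existsP => r r0.
move: (sum_pred); rewrite (bigD1 r) //= => sum_r.
have [m3|m3] := eqVneq (m r) 3%N.
  right; exists r; split=> // i it ir; apply: (eq1 (Ordinal it)); apply/eqP.
  have /eqP : (\sum_(i < t | i != r) (m i).-1)%N = 0%N.
    by move: sum_r; rewrite m3 => -[].
  rewrite sum_nat_eq0 => /forall_inP -> //.
  by apply/eqP => /(congr1 val).
have m2 : m r = 2%N by move: sum_r; move: (bigop.body _ _ _) => n; lia.
have sum_r1 : (\sum_(i < t | i != r) (m i).-1)%N = 1%N by move: sum_r; rewrite m2 => -[].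
have [|/existsPn h0] := boolP [exists k : 'I_t, (k != r) && ((m k).-1 != 0%N)]; last first.
  move: sum_r1; rewrite big1 // => i ir; apply/eqP.
  by have := h0 i; rewrite ir /= negbK.
case/existsP => k /andP[kr k0].
move: (sum_r1); rewrite (bigD1 k) //= => sum_k.
have mk2 : m k = 2%N by move: sum_k; move: (bigop.body _ _ _) => n; lia.
have rest i : (i < t)%N -> i <> r -> i <> k -> m i = 1%N.
  move=> it ir ik; apply: (eq1 (Ordinal it)); apply/eqP.
  have /eqP : (\sum_(i < t | (i != r) && (i != k)) (m i).-1)%N = 0%N.
    by move: sum_k; rewrite mk2 => -[].
  rewrite sum_nat_eq0 => /forall_inP -> //.
  by apply/andP; split; apply/eqP => /(congr1 val).
left; move: kr; rewrite -val_eqE neq_ltn => /orP[] lt_kr.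
  by exists k, r; split=> //; [rewrite lt_kr ltn_ord | move=> i it ? ?; apply: rest].
by exists r, k; split=> //; rewrite lt_kr ltn_ord.
Qed.

(** * The empty partition, which gives the denominator *)

Lemma beta_nil (N : nat) : [seq beta N [::] j | j <- columns N] = rev (iota 0 N).
Proof.
apply: (@eq_from_nth _ 0%N); first by rewrite size_map size_rev !size_iota.
move=> i; rewrite size_map size_iota => iN.
rewrite nth_rev ?size_iota // (nth_map 0%N) ?size_iota // !nth_iota //; last by lia.
by rewrite /beta nth_nil; lia.
Qed.

(** The beta set is [t.+1, t, ..., 0], so the residues 0 and 1 are the repeated ones. This makes the
    denominator an instance of [det_class_beta], with [t] in column 2 and [t.+1] in column 1. *)
Lemma AB_pairs_nil (t : nat) : (2 <= t)%N ->
  AB_pairs t [::] 0 1 t 0 t.+1 1.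
Proof.
move=> t2; left; rewrite /class_parts beta_nil !filter_rev.
have -> : iota 0 (t + 2) = [:: 0; 1]%N ++ iota 2 (t - 2) ++ [:: t; t.+1].
  have -> : (t + 2 = 2 + ((t - 2) + 2))%N by lia.
  by rewrite !iotaD /= ; have -> : (2 + (t - 2) = t)%N by lia.
have midE r : (r < 2)%N -> [seq b <- iota 2 (t - 2) | (b %% t)%N == r] = [::].
  move=> r2; apply/eqP; rewrite -[_ == _]negbK -has_filter -all_predC.
  by apply/allP => b; rewrite mem_iota => bt /=; rewrite modn_small; lia.
have filter2 (p : pred nat) x y : [seq b <- [:: x; y] | p b] =
    (if p x then [:: x] else [::]) ++ (if p y then [:: y] else [::]).
  by rewrite /=; case: (p x).
have m0 : (0 %% t = 0)%N by rewrite mod0n.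
have m1 : (1 %% t = 1)%N by rewrite modn_small.
have mt1 : (t.+1 %% t = 1)%N by rewrite -addn1 modnDl.
rewrite !filter_cat !midE // !cat0s !filter2 m0 m1 modnn mt1 /=.
by rewrite t2.
Qed.

Lemma nres_nil (t r : nat) : (r < t)%N -> nres t [::] r <> 0%N.
Proof.
move=> rt; apply/eqP; rewrite -lt0n -has_count; apply/hasP.
(* The column of the empty partition whose beta number is [r] itself. *)
exists (t + 2 - r)%N; first by rewrite mem_columns; lia.
rewrite /beta nth_nil add0n subKn ?modn_small //; lia.
Qed.

Lemma rev_iotaS (n : nat) : rev (iota 0 n.+1) = n :: rev (iota 0 n).
Proof. by rewrite -addn1 iotaD rev_cat. Qed.

Lemma word_inv_rev_iota (n : nat) : word_inv (rev (iota 0 n)) = 'C(n, 2).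
Proof.
elim: n => [|n IHn]; first by rewrite word_invE big_ord0.
rewrite rev_iotaS word_inv_cons IHn binS bin1 addnC; congr addn.
rewrite -[RHS](size_iota 0) -size_rev; apply/eqP; rewrite -all_count.
by apply/allP => k; rewrite mem_rev mem_iota.
Qed.

Lemma residue_word_nil (t : nat) : residue_word t [::] 2 1 = rev (iota 0 t).
Proof.
have -> : residue_word t [::] 2 1 =
    [seq (b %% t)%N
      | b <- behead (behead [seq beta (t + 2) [::] j | j <- columns (t + 2)])].
  rewrite /residue_word /columns addn2 /= -map_comp; congr map.
  by apply/all_filterP/allP => k; rewrite mem_iota; lia.
rewrite beta_nil addn2 !rev_iotaS /= -[RHS]map_id.
by apply/eq_in_map => k; rewrite mem_rev mem_iota => kt; rewrite modn_small.
Qed.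

(** Here both pair differences equal [t] and the third one is -2. The sign is the source of the
    first factor of [eps]. *)
Lemma det_class_nil (K : fieldType) (t : nat) (w : K) :
    (2 <= t)%N -> w != 0 ->
  \det (class_mx (fun j : 'I_(t + 2) => beta (t + 2) [::] j.+1) (w ^+ 2)) =
    (-1) ^+ (t + 'C((t + 2).+1, 2))
    * ((w ^+ t - w ^- t) ^+ 2 * (w ^+ 2 - w ^- 2)).
Proof.
move=> t2 w0.
rewrite (det_class_beta _ _ _ _ (AB_pairs_nil t2) (jA := 2) (jB := 1));
  rewrite ?/beta ?nth_nil; try lia; try done; last first.
  by move=> r; exact: nres_nil.
rewrite residue_word_nil word_inv_rev_iota sg_subz_nat; last by lia.
rewrite alt2_prod //.
have -> : t%:Z + 0%:Z - t.+1%:Z - 1%:Z = - 2%:Z by lia.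
have -> : t.+1%:Z + 1%:Z - t%:Z - 0%:Z = 2%:Z by lia.
have -> : t%:Z - 0%:Z = t by lia.
have -> : 0%:Z - t%:Z = - t%:Z by lia.
have -> : t.+1%:Z - 1%:Z = t by lia.
have -> : 1%:Z - t.+1%:Z = - t%:Z by lia.
rewrite -!exprnN ltnSn expr1 mulrN1 !rmorphN rmorph_sign /= opprK.
(* Since ['C(t + 3, 2) = 'C(t, 2) + 3 * t + 3], the two exponents differ by [4 * t]. *)
have -> : (-1) ^+ (t + 'C((t + 2).+1, 2)) = (-1) ^+ (2 + 1 + 'C(t, 2)) :> K.
  rewrite -signr_odd -[RHS]signr_odd; congr ((-1) ^+ nat_of_bool _).
  by rewrite addn2 !binS !bin1 !bin0; lia.
by rewrite -!exprnP; ring.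
Qed.

(** * The complex exponential and roots of unity *)

Lemma expC0 (R : realType) : expC (0 : R[i]) = 1.
Proof. by rewrite /expC /= expR0 cos0 sin0 mul1r mulr0. Qed.

Lemma expCD (R : realType) (x y : R[i]) : expC (x + y) = expC x * expC y.
Proof.
case: x y => [a b] [c d]; rewrite /expC /= expRD cosD sinD.
by apply/eqP; rewrite eq_complex /=; apply/andP; split; apply/eqP; ring.
Qed.

Lemma expC_neq0 (R : realType) (x : R[i]) : expC x != 0.
Proof.
have := expCD x (- x); rewrite subrr expC0 => h.
by apply: contra_eq_neq h => ->; rewrite mul0r oner_neq0.
Qed.

Lemma expCN (R : realType) (x : R[i]) : expC (- x) = (expC x)^-1.
Proof.
apply: (mulfI (expC_neq0 x)).
by rewrite -expCD subrr expC0 divff // expC_neq0.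
Qed.

Lemma expC_natM (R : realType) (n : nat) (x : R[i]) : expC (n%:R * x) = expC x ^+ n.
Proof.
elim: n => [|n IHn]; first by rewrite mul0r expC0.
by rewrite -natr1 mulrDl mul1r expCD IHn exprSr.
Qed.

Lemma expC_intM (R : realType) (d : int) (x : R[i]) : expC (d%:~R * x) = expC x ^ d.
Proof.
case: (intP d) => [|n|n]; first by rewrite mul0r expC0.
  exact: (expC_natM n.+1 x).
by rewrite rmorphN mulNr expCN -exprnN (expC_natM n.+1 x).
Qed.

Lemma zetaX (R : realType) (t k : nat) :
  zeta R t ^+ k = Complex (cos (2 * pi / t%:R * k%:R)) (sin (2 * pi / t%:R * k%:R)).
Proof.
rewrite /zeta -expC_natM; have -> : k%:R = real_complex R k%:R by rewrite rmorph_nat.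
by rewrite /expC /= !mul0r !mulr0 subrr addr0 expR0 !mul1r mulrC.
Qed.

Lemma zeta_expr1 (R : realType) (t : nat) : (0 < t)%N -> zeta R t ^+ t = 1.
Proof.
move=> t0; rewrite zetaX mulfVK ?pnatr_eq0 -?lt0n // mulr_natl.
by rewrite cos2pi sin2pi.
Qed.

(** Taking real parts, [zeta R t ^+ k = 1] would give [cos (2 * x) = 1] for [x = pi * k / t], hence
    [sin x = 0], although [0 < x < pi]. *)
Lemma zeta_primitive (R : realType) (t k : nat) :
  (0 < k < t)%N -> zeta R t ^+ k != 1.
Proof.
move=> /andP[k0 kt]; have t0 := ltn_trans k0 kt; rewrite zetaX.
apply/eqP => /(congr1 (@complex.Re R)) /=.
set x : R := pi / t%:R * k%:R.
have -> : 2 * pi / t%:R * k%:R = x *+ 2 by rewrite /x -[RHS]mulr_natl !mulrA.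
have : 0 < sin x.
  rewrite sin_gt0_pi // /x.
  have tR : 0 < t%:R :> R by rewrite ltr0n.
  rewrite -mulrA pmulr_rgt0 ?pi_gt0 // mulr_gt0 ?invr_gt0 ?ltr0n //=.
  by rewrite gtr_pMr ?pi_gt0 // mulrC ltr_pdivrMr // mul1r ltr_nat.
rewrite cos_mulr2n cos2sin2 => sx0 /eqP; rewrite subr_eq => /eqP h.
have /eqP : sin x ^+ 2 = 0 by lra.
by rewrite expf_eq0 /= gt_eqF.
Qed.

Lemma det_fourier_neq0 (R : realType) (t : nat) :
  \det (\matrix_(i < t, r < t) zeta R t ^+ (i * r)) != 0.
Proof.
pose a : 'rV[R[i]]_t := \row_i zeta R t ^+ i.
have -> : \matrix_(i < t, r < t) zeta R t ^+ (i * r) = Vandermonde t a.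
  by apply/matrixP => i j; rewrite !mxE mulnC exprM.
rewrite det_Vandermonde; apply/prodf_neq0 => i _; apply/prodf_neq0 => j ij.
rewrite !mxE -(subnK (ltnW ij)) exprD -{2}[_ ^+ i]mul1r -mulrBl mulf_neq0 //.
  rewrite subr_eq0 zeta_primitive // subn_gt0 ij /=.
  exact: leq_ltn_trans (leq_subr _ _) (ltn_ord j).
by rewrite expf_neq0 // expC_neq0.
Qed.

(** * Specialization of the Schur polynomial *)

Lemma rmorph_alternant (A B : comNzRingType) (f : {rmorphism A -> B}) (n : nat)
    (x : 'I_n -> A) (lam : seq nat) :
  f (alternant x lam) = alternant (f \o x) lam.
Proof.
rewrite /alternant -det_map_mx; congr (\det _).
by apply/matrixP => i j; rewrite !mxE rmorphXn.
Qed.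

(** Evaluation at a point is a ring morphism, so it carries over the identity defining [schur]. The
    multiplicative form stays valid where the denominator vanishes. *)
Lemma Phi_alternant (R : realType) (t : nat) (lam : seq nat) (z : R[i]) :
  Phi t lam z * alternant (@Phi_point R t z) [::] = alternant (@Phi_point R t z) lam.
Proof.
have := congr1 (mpoly.mmap intr (@Phi_point R t z)) (schurP (t + 2) lam).
rewrite (rmorphM (mpoly.mmap intr (@Phi_point R t z))) !rmorph_alternant.
have altE mu : alternant (mpoly.mmap intr (@Phi_point R t z) \o @mpvar (t + 2)) mu
    = alternant (@Phi_point R t z) mu.
  congr (\det _); apply/matrixP => i j; rewrite !mxE /=.
  by rewrite /mpvar mpoly.mmapX mpoly.mmap1U.
by rewrite !altE.
Qed.

Lemma Phi_class_mx (R : realType) (t : nat) (lam : seq nat) (z : R[i]) :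
    (0 < t)%N ->
  Phi t lam z * \det (class_mx (fun j : 'I_(t + 2) => beta (t + 2) [::] j.+1) z) =
  \det (class_mx (fun j : 'I_(t + 2) => beta (t + 2) lam j.+1) z).
Proof.
move=> t0; have := Phi_alternant t lam z.
rewrite !(@alternant_class_mx _ t (zeta R t) z _ t0 (zeta_expr1 R t0)) mulrCA.
exact/mulfI/det_fourier_neq0.
Qed.

(** * Laurent polynomial functions and vanishing *)

(** The power [z ^+ M] clears the pole at 0. Nothing is asked at 0 itself, where [z^-1] takes a
    default value. *)
Definition laurent (K : fieldType) (f : K -> K) : Prop :=
  exists (M : nat) (P : {poly K}), forall z, z != 0 -> f z * z ^+ M = P.[z].

Lemma laurentC (K : fieldType) (c : K) : laurent (fun=> c).
Proof. by exists 0%N, c%:P => z _; rewrite hornerC mulr1. Qed.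

Lemma laurentD (K : fieldType) (f g : K -> K) :
  laurent f -> laurent g -> laurent (fun z => f z + g z).
Proof.
move=> [M [P fP]] [N [Q gQ]]; exists (M + N)%N, (P * 'X^N + Q * 'X^M) => z z0.
rewrite hornerD !hornerM !hornerXn -fP // -gQ // exprD; ring.
Qed.

Lemma laurentM (K : fieldType) (f g : K -> K) :
  laurent f -> laurent g -> laurent (fun z => f z * g z).
Proof.
move=> [M [P fP]] [N [Q gQ]]; exists (M + N)%N, (P * Q) => z z0.
rewrite hornerM -fP // -gQ // exprD; ring.
Qed.

Lemma laurentX (K : fieldType) (f : K -> K) (n : nat) :
  laurent f -> laurent (fun z => f z ^+ n).
Proof.
move=> [M [P fP]]; exists (M * n)%N, (P ^+ n) => z z0.
by rewrite horner_exp -fP // exprMn exprM.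
Qed.

Lemma laurent_sum (K : fieldType) (I : Type) (s : seq I) (F : I -> K -> K) :
  (forall i, laurent (F i)) -> laurent (fun z => \sum_(i <- s) F i z).
Proof.
move=> LF; elim: s => [|i s [M [P IHs]]].
  by exists 0%N, 0 => z _; rewrite big_nil mul0r horner0.
have [N [Q sQ]] : laurent (fun z => F i z + \sum_(i <- s) F i z).
  by apply: laurentD => //; exists M, P.
by exists N, Q => z z0; rewrite big_cons sQ.
Qed.

Lemma laurent_prod (K : fieldType) (I : Type) (s : seq I) (F : I -> K -> K) :
  (forall i, laurent (F i)) -> laurent (fun z => \prod_(i <- s) F i z).
Proof.
move=> LF; elim: s => [|i s [M [P IHs]]].
  by exists 0%N, 1 => z _; rewrite big_nil mulr1 hornerC.
have [N [Q sQ]] : laurent (fun z => F i z * \prod_(i <- s) F i z).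
  by apply: laurentM => //; exists M, P.
by exists N, Q => z z0; rewrite big_cons sQ.
Qed.

(** Evaluation is a finite sum of monomials in the coordinates of the point, each of which is a
    constant, [z] or [z^-1]. *)
Lemma laurent_Phi (R : realType) (t : nat) (lam : seq nat) :
  laurent (@Phi R t lam).
Proof.
rewrite /Phi /mpoly.mmap /mpoly.mmap1; apply: laurent_sum => m.
apply: laurentM; first exact: laurentC.
apply: laurent_prod => i; apply: laurentX; rewrite /Phi_point.
case: (i < t)%N; first exact: laurentC.
case: (i == t :> nat); first by exists 0%N, 'X => z _; rewrite hornerX mulr1.
by exists 1%N, 1 => z z0; rewrite hornerC mulVf.
Qed.

(* The sample points [(n + 2) ^ 2] are squares of numbers that are not roots of
   unity, so the alternant of the empty partition does not vanish there. *)
Lemma laurent_eq0 (R : realType) (f : R[i] -> R[i]) :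
    laurent f -> (forall n : nat, f (n.+2%:R ^+ 2) = 0) ->
  forall z, z != 0 -> f z = 0.
Proof.
move=> [M [P fP]] f0 z z0.
have P0 : P = 0.
  apply: contraTeq isT => /max_poly_roots P_neq0.
  (* These are [size P] distinct roots, one more than the degree of a nonzero [P] allows. *)
  have := P_neq0 [seq n.+2%:R ^+ 2 | n <- iota 0 (size P)].
  rewrite size_map size_iota ltnn; apply.
    apply/allP => _ /mapP[n _ ->]; apply/eqP.
    by rewrite -fP ?f0 ?mul0r // expf_neq0 // pnatr_eq0.
  rewrite map_inj_uniq ?iota_uniq // => m n /eqP.
  rewrite eqrXn2 ?ler0n // eqr_nat => /eqP; lia.
by apply: (mulIf (expf_neq0 M z0)); rewrite fP // P0 horner0 mul0r.
Qed.

Lemma sinhC_intM (R : realType) (d : int) (x : R[i]) :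
  sinhC (d%:~R * x) = (expC x ^ d - expC x ^ (- d)) / 2.
Proof. by rewrite /sinhC -mulNr -rmorphN !expC_intM. Qed.

Lemma sinhC_natM (R : realType) (n : nat) (x : R[i]) :
  sinhC (n%:R * x) = (expC x ^+ n - expC x ^- n) / 2.
Proof. by rewrite /sinhC expCN expC_natM. Qed.

Lemma sinhCN (R : realType) (x : R[i]) : sinhC (- x) = - sinhC x.
Proof. by rewrite /sinhC opprK -mulNr opprB. Qed.

Lemma natrX_subV_neq0 (R : realType) (n k : nat) : (0 < k)%N ->
  n.+2%:R ^+ k - n.+2%:R ^- k != 0 :> R[i].
Proof.
move=> k0; have nk0 : n.+2%:R ^+ k != 0 :> R[i] by rewrite expf_neq0 ?pnatr_eq0.
rewrite subr_eq0; apply/eqP => /(congr1 (fun x => x * n.+2%:R ^+ k)).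
rewrite mulVf // -exprD -natrX => /eqP; rewrite pnatr_eq1.
by rewrite -(expn0 n.+2) eqn_exp2l // addn_eq0 (gtn_eqF k0).
Qed.

(** At a root of the denominator the quotient gives no information. Vanishing is obtained first at
    the sample points, where [det_class_nil] gives a nonzero value, and then spreads by
    [laurent_eq0]. *)
Lemma Phi_eq0 (R : realType) (t : nat) (lam : seq nat) : (2 <= t)%N ->
    (forall w : R[i], w != 0 ->
       \det (class_mx (fun j : 'I_(t + 2) => beta (t + 2) lam j.+1) (w ^+ 2)) = 0) ->
  forall z : R[i], z != 0 -> Phi t lam z = 0.
Proof.
move=> t2 det0; have t0 := ltnW t2; apply: laurent_eq0; first exact: laurent_Phi.
move=> n; have w0 : n.+2%:R != 0 :> R[i] by rewrite pnatr_eq0.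
have := Phi_class_mx lam (n.+2%:R ^+ 2 : R[i]) t0.
rewrite det0 // det_class_nil // => /eqP; rewrite mulf_eq0 => /orP[/eqP//|].
rewrite mulf_eq0 signr_eq0 mulf_eq0 expf_eq0 /=.
by rewrite (negPf (natrX_subV_neq0 R n t0)) (negPf (@natrX_subV_neq0 R n 2 _)).
Qed.

Lemma det_class_mx_empty_class (K : fieldType) (t : nat) (lam : seq nat) (r : nat) (z : K) :
    (r < t)%N -> nres t lam r = 0%N ->
  \det (class_mx (fun j : 'I_(t + 2) => beta (t + 2) lam j.+1) z) = 0.
Proof.
move=> rt /eqP; rewrite -[_ == _]negbK -lt0n -has_count => /hasPn n0.
rewrite (expand_det_row _ (lshift 2 (Ordinal rt))) big1 // => j _.
rewrite col_mxEu !mxE (negPf (n0 j.+1 _)) ?mul0r // mem_columns /=.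
exact: ltn_ord.
Qed.

Theorem theorem3p1 (R : realType) (t : nat) (lam : seq nat)
    (ht : (2 <= t)%N) (hlam : sorted geq lam) (hsize : (size lam <= t + 2)%N) :
  ((exists2 i : nat, (i < t)%N & nres t lam i = 0%N) ->
     forall z : R[i], z != 0 -> Phi t lam z = 0)
  /\
  ((forall i : nat, (i < t)%N -> nres t lam i <> 0%N) ->
     (two_double_classes t lam \/ one_triple_class t lam)
     /\
     forall rA rB a1 a2 b1 b2 jA jB : nat,
       AB_pairs t lam rA rB a1 a2 b1 b2 ->
       (1 <= jA <= t + 2)%N -> beta (t + 2) lam jA = a1 ->
       (1 <= jB <= t + 2)%N -> beta (t + 2) lam jB = b1 ->
       let d1 : int := a1%:Z - a2%:Z in
       let d2 : int := b1%:Z - b2%:Z in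
       let d3t : int := a1%:Z + a2%:Z - b1%:Z - b2%:Z in
       let d3 : int := `|d3t| in
       let e : int := eps t lam a1 b1 jA jB d3t in
       (d3t = 0 -> forall z : R[i], z != 0 -> Phi t lam z = 0)
       /\
       (d3t <> 0 ->
          (e = 1 \/ e = -1)
          /\
          forall theta : R[i],
            sinhC (t%:R * theta / 2) != 0 -> sinhC theta != 0 ->
            Phi t lam (expC theta)
            = e%:~R
              * (sinhC (d1%:~R * theta / 2) * sinhC (d2%:~R * theta / 2)
                 * sinhC (d3%:~R * theta / 2))
              / (sinhC (t%:R * theta / 2) ^+ 2 * sinhC theta))).
Proof.
have t0 := ltnW ht.
split=> [[r rt nr0]|n_neq0].
  by apply: Phi_eq0 => // w _; exact: det_class_mx_empty_class rt nr0.
split; first exact/sum_add2_profile/n_neq0/sum_nres.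
move=> rA rB a1 a2 b1 b2 jA jB AB jAN bA jBN bB d1 d2 d3t d3 e.
have detE z := @det_class_beta R[i] t lam rA rB a1 a2 b1 b2 jA jB z
  t0 hlam n_neq0 AB jAN bA jBN bB.
have d3tN : b1%:Z + b2%:Z - a1%:Z - a2%:Z = - d3t by rewrite /d3t; lia.
have d1N : a2%:Z - a1%:Z = - d1 by rewrite /d1; lia.
have d2N : b2%:Z - b1%:Z = - d2 by rewrite /d2; lia.
split=> [d3t0|d3t_neq0].
  apply: Phi_eq0 => // w w0.
  by rewrite detE alt2_prod // d3tN -/d3t d3t0 oppr0 subrr mulr0 oppr0 mulr0.
have [[jAB _ _ _ _] _] := AB_pairs_columns hlam AB jAN bA jBN bB.
have ab : a1 != b1.
  by rewrite -bA -bB; apply: contra jAB => /eqP/(beta_inj hlam jAN jBN)->.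
have sg3 : Num.sg d3t = (-1) ^+ (d3t < 0)%R by rewrite neqr0_sign //; apply/eqP.
split.
  rewrite /e /eps sg3 sg_subz_nat // -!exprD -signr_odd.
  by case: (odd _); [right|left].
(* With [w = expC x] one has [expC theta = w ^+ 2], and every hyperbolic sine is taken at an integer
   multiple of [x]. *)
move=> theta; pose x := theta / 2.
have xE c : c * theta / 2 = c * x by rewrite mulrA.
have thetaE : theta = 2%:R * x by rewrite /x mulrC divfK ?pnatr_eq0.
(* The absolute value is traded for a sign because [sinhC] is odd; this sign cancels the last factor
   of [eps]. *)
have d3E : sinhC (d3%:~R * x) = (Num.sg d3t)%:~R * sinhC (d3t%:~R * x).
  rewrite /d3 normrEsg sg3 rmorphM -mulrA rmorph_sign.
  by case: (d3t < 0); rewrite ?mul1r // !mulN1r sinhCN.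
rewrite !xE d3E [in sinhC theta]thetaE [in expC theta]thetaE !sinhC_intM !sinhC_natM expC_natM.
have := expC_neq0 x; move: (expC x) => w w0 St_neq0 S2_neq0.
have := Phi_class_mx lam (w ^+ 2) t0.
rewrite detE alt2_prod // det_class_nil // -/d1 -/d2 -/d3t d1N d2N d3tN.
rewrite /e /eps !rmorphM !rmorph_sign /=.
have sgK : (Num.sg d3t)%:~R * (Num.sg d3t)%:~R = 1 :> R[i].
  by rewrite sg3 -rmorphM -signr_addb addbb.
have signK n : (-1) ^+ n * (-1) ^+ n = 1 :> R[i] by rewrite -expr2 sqrr_sign.
move: St_neq0 S2_neq0; rewrite !mulf_eq0 !negb_or => /andP[T0 two0] /andP[S0 _].
move: (signK (t + 'C((t + 2).+1, 2))%N) sgK T0 S0.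
move: (_ ^+ (t + _)) (_ ^+ (jA + jB + _)) (_ - w ^- t) (_ - w ^- 2).
move: (_ - w ^ (- d1)) (_ - w ^ (- d2)) (_ - w ^ (- d3t)) (Num.sg d3t)%:~R.
move: (Num.sg (a1%:Z - b1%:Z))%:~R (Phi _ _ _) => s1 F D1 D2 D3 s3 E J T S EE s33 T0 S0 H.
have E0 : E != 0 by apply: contra_eq_neq EE => ->; rewrite mul0r eq_sym oner_neq0.
apply: (mulIf (mulf_neq0 E0 (mulf_neq0 (expf_neq0 2 T0) S0))); rewrite H.
(* The sign [E] comes from [eps] and from the denominator, [s3] from [eps] and from [d3E], so both
   square to 1. The three halves of the numerator cancel those of the denominator. *)
transitivity (E * E * (s3 * s3) * (J * s1 * (D1 * D2 * D3))).
  by rewrite EE s33; ring.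
by field; rewrite T0 S0.
Qed.
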